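(* There exist T-sequences of length $79$, and there also exists an orthogonal design $OD(4d;d,d,d,d)$ with $d=79$.
   Context: For a finite integer sequence $X=(x_1,\ldots,x_\ell)$, its nonperiodic autocorrelation function is $N_X(s)=\sum_{i=1}^{\ell-s}x_i x_{i+s}$ for integers $s\ge 0$, with the convention that $N_X(s)=0$ for $s\ge \ell$. T-sequences of length $n$ are quadruples $(A;B;C;D)$ of sequences of length $n$ with terms in $\{0,+1,-1\}$ such that for each position $i\in\{1,\ldots,n\}$ exactly one of the four terms $a_i,b_i,c_i,d_i$ is nonzero, and $N_A(s)+N_B(s)+N_C(s)+N_D(s)=0$ for all $s\ge 1$. An orthogonal design $OD(4d;d,d,d,d)$ is a $4d\times 4d$ matrix $M$ with entries in $\{0,\pm x_1,\pm x_2,\pm x_3,\pm x_4\}$, where $x_1,x_2,x_3,x_4$ are commuting indeterminates, such that $MM^T=d(x_1^2+x_2^2+x_3^2+x_4^2)I_{4d}$, where $T$ denotes transposition and $I_{4d}$ is the identity matrix. *)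

(* Defs.v *)
From mathcomp Require Import all_boot all_order all_algebra.
From mathcomp Require Import mpoly.

Set Implicit Arguments.
Unset Strict Implicit.
Unset Printing Implicit Defensive.

Import GRing.Theory.
Local Open Scope ring_scope.

(* Positions are numbered from 0.  For s >= size X the truncated subtraction
   makes the range empty, so that N_X(s) = 0. *)
Definition autocorr (X : seq int) (s : nat) : int :=
  \sum_(0 <= i < size X - s) X`_i * X`_(i + s).

Definition T_sequences (n : nat) (A B C D : n.-tuple int) : Prop :=
  [/\ {subset A ++ B ++ C ++ D <= [:: 0; 1; -1]},
      forall i : 'I_n,
        count (fun X : n.-tuple int => tnth X i != 0) [:: A; B; C; D] = 1%N
    & forall s : nat, (1 <= s)%N ->
        autocorr A s + autocorr B s + autocorr C s + autocorr D s = 0].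

(* OD(4d; d, d, d, d); the commuting indeterminates x_1, ..., x_4 are the
   variables 'X_0, ..., 'X_3 of the integer polynomial ring in 4 variables. *)
Definition orthogonal_design4 (d : nat) (M : 'M[{mpoly int[4]}]_(4 * d)) :
    Prop :=
  (forall i j, M i j = 0 \/ exists k : 'I_4, M i j = 'X_k \/ M i j = - 'X_k)
  /\ M *m M^T = (d%:R * \sum_(k < 4) 'X_k ^+ 2)%:M.

(* Main.v *)
Require Import Defs.
From mathcomp Require Import all_boot all_order all_algebra.
From mathcomp Require Import mpoly.
From mathcomp Require Import ring zify.

(** Base sequences are quadruples of sequences with terms 1 and -1, two of
    length m and two of length n, whose autocorrelations sum to zero at every
    positive shift.  From the pair of length m one forms the half sum and the
    half difference: they have disjoint supports covering all m positions, and
    their autocorrelations add up to half of those of the pair.  Padding the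
    two sequences obtained from the first pair by n zeros on the right, and
    the two obtained from the second pair by m zeros on the left, gives
    T-sequences of length m + n.  Base sequences of lengths 40, 40, 39, 39 are
    exhibited below; they were found by a meet-in-the-middle search (matching
    the autocorrelations of the two pairs), and what has to be proved about
    them is a finite computation ([T_checkP]).

    The orthogonal design comes from T-sequences of any positive length d
    ([orthogonal_design_of_T_sequences]).  Wrapping them around gives functions
    a, b, c, d on Z/d whose periodic autocorrelations sum to zero off the
    origin, because the periodic autocorrelation at t collects the nonperiodic
    ones at t and at d - t ([T_sequences_periodic]).  Combining a, b, c, d with
    the rows of a 4 x 4 orthogonal design in x_1, ..., x_4 yields four functions
    with values among the +-x_k whose autocorrelations sum to
    d (x_1^2 + ... + x_4^2) at the origin and to 0 elsewhere
    ([orthogonal_sum]).  The Goethals-Seidel array turns any such four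
    functions into a 4d x 4d matrix with orthogonal rows
    ([goethals_seidel_orthogonal]). *)

Set Implicit Arguments.
Unset Strict Implicit.
Unset Printing Implicit Defensive.

Import GRing.Theory.
Local Open Scope ring_scope.

(** * Correlation and convolution on Z/(m+1) *)

Definition corr (R : comNzRingType) (m : nat) (f g : 'I_m.+1 -> R)
  (t : 'I_m.+1) : R := \sum_j f j * g (j + t).

Definition conv (R : comNzRingType) (m : nat) (f g : 'I_m.+1 -> R)
  (t : 'I_m.+1) : R := \sum_j f j * g (t - j).

Lemma corrC (R : comNzRingType) (m : nat) (f g : 'I_m.+1 -> R) t :
  corr f g t = corr g f (- t).
Proof.
rewrite /corr (reindex_inj (addIr (- t))).
by apply: eq_bigr => j _; rewrite subrK mulrC.
Qed.

Lemma convC (R : comNzRingType) (m : nat) (f g : 'I_m.+1 -> R) t :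
  conv f g t = conv g f t.
Proof.
rewrite /conv (reindex_inj (can_inj (subKr t))).
by apply: eq_bigr => j _; rewrite subKr mulrC.
Qed.

Lemma sum_shift_shift (R : comNzRingType) (m : nat) (f g : 'I_m.+1 -> R) i k :
  \sum_j f (i + j) * g (k + j) = corr f g (k - i).
Proof.
rewrite /corr (reindex_inj (addrI (- i))); apply: eq_bigr => j _.
by rewrite addNKr addrA [_ + j]addrC.
Qed.

Lemma sum_shift_flip (R : comNzRingType) (m : nat) (f g : 'I_m.+1 -> R) i k :
  \sum_j f (i + j) * g (- (k + j)) = conv f g (i - k).
Proof.
rewrite /conv (reindex_inj (addrI (- i))); apply: eq_bigr => j _.
by rewrite addNKr !opprD opprK addrA (addrC (- k)).
Qed.

Lemma sum_flip_shift (R : comNzRingType) (m : nat) (f g : 'I_m.+1 -> R) i k :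
  \sum_j f (- (i + j)) * g (k + j) = conv f g (k - i).
Proof.
by rewrite convC -sum_shift_flip; apply: eq_bigr => j _; rewrite mulrC.
Qed.

Lemma sum_flip_flip (R : comNzRingType) (m : nat) (f g : 'I_m.+1 -> R) i k :
  \sum_j f (- (i + j)) * g (- (k + j)) = corr f g (i - k).
Proof.
rewrite /corr (reindex_inj (inj_comp (addIr (- i)) oppr_inj)).
apply: eq_bigr => j _ /=.
by rewrite !(addrCA _ (- j)) subrr addr0 opprD !opprK opprB.
Qed.

(** * The Goethals-Seidel array *)

(** Row and column indices are pairs (block, position in Z/(m+1)).  A block
    [c f] is the circulant of [f]; reversing the order of its columns makes it
    back-circulant, that is, a function of the sum of the two positions: [r f]
    is the reversed circulant and [l f] the reversed transposed circulant. *)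
Definition goethals_seidel (R : comNzRingType) (m : nat)
    (f0 f1 f2 f3 : 'I_m.+1 -> R) (p q : 'I_4 * 'I_m.+1) : R :=
  let c f := f (- p.2 + q.2) in
  let l f := f (p.2 + q.2) in
  let r f := f (- (p.2 + q.2)) in
  nth 0 (nth [::]
    [:: [::    c f0;    r f1;    r f2;    r f3];
        [:: - r f1;    c f0;    l f3;  - l f2];
        [:: - r f2;  - l f3;    c f0;    l f1];
        [:: - r f3;    l f2;  - l f1;    c f0]] p.1) q.1.

(** The scalar product of two rows is a sum of four correlations or
    convolutions.  For rows of the same block row these are the four
    autocorrelations at the difference of the positions.  For rows of
    different block rows they cancel in pairs, since convolution is commutative
    and exchanging the two functions in a correlation reflects its argument. *)
Lemma goethals_seidel_orthogonal (R : comNzRingType) (m : nat)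
    (f0 f1 f2 f3 : 'I_m.+1 -> R) (w : R) :
  (forall t, corr f0 f0 t + corr f1 f1 t + corr f2 f2 t + corr f3 f3 t
             = w *+ (t == 0)) ->
  forall p q, \sum_s goethals_seidel f0 f1 f2 f3 p s *
                     goethals_seidel f0 f1 f2 f3 q s = w *+ (p == q).
Proof.
move=> hw [u i] [v k].
have sum4 (F : 'I_4 -> R) : \sum_a F a = F ord0 + (F (lift ord0 ord0) +
    (F (lift ord0 (lift ord0 ord0)) + F (lift ord0 (lift ord0 (lift ord0 ord0))))).
  by rewrite !big_ord_recl big_ord0 addr0.
rewrite -[LHS](pair_bigA _ (fun a b =>
  goethals_seidel f0 f1 f2 f3 (u, i) (a, b) *
  goethals_seidel f0 f1 f2 f3 (v, k) (a, b))) sum4 /goethals_seidel /=.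
have sumNl (F G : 'I_m.+1 -> R) : \sum_j - F j * G j = - \sum_j F j * G j.
  by rewrite -sumrN; apply: eq_bigr => j _; rewrite mulNr.
have sumNr (F G : 'I_m.+1 -> R) : \sum_j F j * - G j = - \sum_j F j * G j.
  by rewrite -sumrN; apply: eq_bigr => j _; rewrite mulrN.
have diag (a b : 'I_4) : a = b -> ((a, i) == (b, k)) = (i - k == 0).
  by move=> ->; rewrite xpair_eqE eqxx subr_eq0.
have even f : corr f f (k - i) = corr f f (i - k) by rewrite corrC opprB.
(* Orienting every mixed term so that the lower index comes first makes the
   cancelling terms syntactically equal. *)
have swap := (corrC f3 f0, corrC f3 f1, corrC f3 f2, corrC f2 f0, corrC f2 f1,
  corrC f1 f0, convC f3 f0, convC f3 f1, convC f3 f2, convC f2 f0, convC f2 f1,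
  convC f1 f0).
case: u => [[|[|[|[|//]]]] hu]; case: v => [[|[|[|[|//]]]] hv] /=;
  rewrite ?(sumNl, sumNr) ?opprK
    ?(sum_flip_flip, sum_flip_shift, sum_shift_flip, sum_shift_shift) ?opprK.
all: try by rewrite mulr0n ?swap ?opprD ?opprK ?(addrC (- k)) ?(addrC k); ring.
all: rewrite diag -?hw; last exact: val_inj.
all: rewrite ?even ?(addrC (- k)); ring.
Qed.

(** * From T-sequences to an orthogonal design *)

(** The four combinations are the rows of the 4 x 4 orthogonal design in
    x0, ..., x3; its columns are orthogonal as well, so the mixed products such
    as a * b' disappear from the sum. *)
Lemma orthogonal_sum (R : comNzRingType) (x0 x1 x2 x3 a b c d a' b' c' d' : R) :
  (x0 * a + x1 * b + x2 * c + x3 * d) * (x0 * a' + x1 * b' + x2 * c' + x3 * d') +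
  (x0 * b - x1 * a - x2 * d + x3 * c) * (x0 * b' - x1 * a' - x2 * d' + x3 * c') +
  (x0 * c + x1 * d - x2 * a - x3 * b) * (x0 * c' + x1 * d' - x2 * a' - x3 * b') +
  (x0 * d - x1 * c + x2 * b - x3 * a) * (x0 * d' - x1 * c' + x2 * b' - x3 * a') =
  (x0 ^+ 2 + x1 ^+ 2 + x2 ^+ 2 + x3 ^+ 2) * (a * a' + b * b' + c * c' + d * d').
Proof. ring. Qed.

(** The pairs (j, j + t) that do not wrap around give the autocorrelation at t;
    those that do, read from the other end, give the one at m + 1 - t. *)
Lemma periodic_autocorr (m : nat) (X : m.+1.-tuple int) (t : 'I_m.+1) :
  corr (tnth X) (tnth X) t = autocorr X t + autocorr X (m.+1 - t)%N.
Proof.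
rewrite /corr /autocorr size_tuple subKn; last exact: ltnW.
have le_t : (m.+1 - t <= m.+1)%N by exact: leq_subr.
rewrite (eq_bigr (fun j : 'I_m.+1 => X`_j * X`_((j + t) %% m.+1)%N)); last first.
  by move=> j _; rewrite !(tnth_nth 0).
rewrite -(big_mkord xpredT (fun j => X`_j * X`_((j + t) %% m.+1)%N)).
rewrite (big_cat_nat (leq0n _) le_t) /=; congr (_ + _).
  apply: eq_big_nat => j /andP[_ hj]; rewrite modn_small //; lia.
rewrite -{1}[(m.+1 - t)%N]add0n big_addn subKn; last exact: ltnW.
apply: eq_big_nat => j /andP[_ hj]; rewrite mulrC.
have -> : (j + (m.+1 - t) + t = j + m.+1)%N by have := ltn_ord t; lia.
by rewrite modnDr modn_small //; have := ltn_ord t; lia.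
Qed.

Lemma T_sequences_squares (n : nat) (A B C D : n.-tuple int) (i : 'I_n) :
  T_sequences A B C D ->
  tnth A i * tnth A i + tnth B i * tnth B i + tnth C i * tnth C i +
  tnth D i * tnth D i = 1.
Proof.
case=> sub /(_ i) one _.
have val (X : n.-tuple int) : {subset X <= A ++ B ++ C ++ D} ->
    tnth X i * tnth X i = (tnth X i != 0)%:R.
  move=> sX; have := sub _ (sX _ (mem_tnth i X)).
  by rewrite !inE => /or3P[] /eqP->.
rewrite !val; try by move=> x; rewrite !mem_cat => ->; rewrite ?orbT.
move: one => /=.
by do 4![case: (_ != 0)].
Qed.

(** Off the origin the two nonperiodic sums vanish; at the origin exactly one
    of the four squares at each position is 1. *)
Lemma T_sequences_periodic (m : nat) (A B C D : m.+1.-tuple int)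
    (t : 'I_m.+1) : T_sequences A B C D ->
  \sum_j (tnth A j * tnth A (j + t) + tnth B j * tnth B (j + t) +
          tnth C j * tnth C (j + t) + tnth D j * tnth D (j + t)) =
  m.+1%:R *+ (t == 0).
Proof.
move=> T; have [-> | t0] := eqVneq.
  under eq_bigr do rewrite addr0 (T_sequences_squares _ T).
  by rewrite sumr_const card_ord.
rewrite !big_split -!/(corr (tnth _) (tnth _) t) !periodic_autocorr //.
case: T => _ _ sum0.
have tn0 : (0 < t)%N by rewrite lt0n -(inj_eq val_inj) in t0 *.
have nt0 : (0 < m.+1 - t)%N by rewrite subn_gt0.
by move: (sum0 _ tn0) (sum0 _ nt0); rewrite mulr0n /=; lia.
Qed.

Lemma orthogonal_design_of_T_sequences (m : nat) (A B C D : m.+1.-tuple int) :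
  T_sequences A B C D ->
  exists M : 'M[{mpoly int[4]}]_(4 * m.+1), orthogonal_design4 M.
Proof.
move=> T; pose x k : {mpoly int[4]} := 'X_(inord k : 'I_4).
pose c (X : m.+1.-tuple int) j : {mpoly int[4]} := (tnth X j)%:~R.
pose f0 j := x 0%N * c A j + x 1%N * c B j + x 2%N * c C j + x 3%N * c D j.
pose f1 j := x 0%N * c B j - x 1%N * c A j - x 2%N * c D j + x 3%N * c C j.
pose f2 j := x 0%N * c C j + x 1%N * c D j - x 2%N * c A j - x 3%N * c B j.
pose f3 j := x 0%N * c D j - x 1%N * c C j + x 2%N * c B j - x 3%N * c A j.
pose w : {mpoly int[4]} := m.+1%:R * \sum_(k < 4) 'X_k ^+ 2.
have sumX : \sum_(k < 4) 'X_k ^+ 2 =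
    x 0%N ^+ 2 + x 1%N ^+ 2 + x 2%N ^+ 2 + x 3%N ^+ 2.
  rewrite !big_ord_recr big_ord0 /= add0r.
  by do !congr (_ + _); congr ('X_ _ ^+ 2); apply: val_inj; rewrite /= inordK.
have corr_sum t : corr f0 f0 t + corr f1 f1 t + corr f2 f2 t + corr f3 f3 t =
    w *+ (t == 0).
  rewrite /corr -!big_split /=; under eq_bigr do rewrite orthogonal_sum.
  rewrite -mulr_sumr -sumX /w (mulrC m.+1%:R) -mulrnAr; congr (_ * _).
  have := congr1 (fun z : int => z%:~R : {mpoly int[4]})
    (T_sequences_periodic t T).
  rewrite rmorph_sum rmorphMn rmorph_nat => <-.
  by apply: eq_bigr => j _; rewrite !rmorphD !rmorphM.
pose entry (r : {mpoly int[4]}) :=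
  r = 0 \/ exists k : 'I_4, r = 'X_k \/ r = - 'X_k.
have entryN r : entry r -> entry (- r).
  case=> [->|[k [] ->]]; first by left; rewrite oppr0.
    by right; exists k; right.
  by right; exists k; left; rewrite opprK.
have entryX k : entry (x k) by right; exists (inord k); left.
have entryF j : [/\ entry (f0 j), entry (f1 j), entry (f2 j) & entry (f3 j)].
  case: T => sub /(_ j) one _; rewrite /f0 /f1 /f2 /f3 /c.
  have val (X : m.+1.-tuple int) : {subset X <= A ++ B ++ C ++ D} ->
      tnth X j \in [:: 0; 1; -1] by move=> sX; apply/sub/sX/mem_tnth.
  have [vA vB vC vD] : [/\ tnth A j \in [:: 0; 1; -1], tnth B j \in [:: 0; 1; -1],
      tnth C j \in [:: 0; 1; -1] & tnth D j \in [:: 0; 1; -1]].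
    by split; apply: val => y; rewrite !mem_cat => ->; rewrite ?orbT.
  move: vA vB vC vD one => /=; rewrite !inE.
  have entryNX k : entry (- x k) := entryN _ (entryX k).
  (* Of the 81 sign patterns, the 8 with a single nonzero term survive. *)
  do 4![case/or3P => /eqP ->] => //= _;
    by rewrite !(rmorph0, rmorph1, rmorphN1, mulrN1, mulr1, mulr0,
    opprK, oppr0, addr0, add0r, subr0, sub0r).
(* Rows and columns are numbered by pairs through the bijection that stores a
   matrix row by row. *)
have [g gK Kg] := curry_mxvec_bij 4 m.+1.
have {}gK p : g (uncurry (@mxvec_index 4 m.+1) p) = p by exact: gK.
have {}Kg i : uncurry (@mxvec_index 4 m.+1) (g i) = i by exact: Kg.
exists (\matrix_(i, j) goethals_seidel f0 f1 f2 f3 (g i) (g j)); split.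
  move=> i j; rewrite mxE -/(entry _) /goethals_seidel.
  move: (g i) (g j) => [u k] [v l] /=.
  have [? _ _ _] := entryF (- k + l).
  have [_ r1 r2 r3] := entryF (- (k + l)).
  have [_ l1 l2 l3] := entryF (k + l).
  by case: u => [[|[|[|[|//]]]] hu]; case: v => [[|[|[|[|//]]]] hv] /=; auto.
apply/matrixP => i j; rewrite !mxE (reindex _ (curry_mxvec_bij 4 m.+1)) /=.
under eq_bigr do rewrite !mxE gK.
by rewrite (goethals_seidel_orthogonal corr_sum) (inj_eq (can_inj Kg)).
Qed.

(** * Checking T-sequences by computation *)

(** Same sum as in [autocorr], over a list fold that evaluates. *)
Definition autocorr_fold (X : seq int) (s : nat) : int :=
  foldr (fun i z => X`_i * X`_(i + s) + z) 0 (iota 0 (size X - s)).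

Lemma autocorr_foldE (X : seq int) (s : nat) : autocorr X s = autocorr_fold X s.
Proof. by rewrite /autocorr /index_iota subn0 unlock. Qed.

Definition T_check (n : nat) (A B C D : seq int) : bool :=
  [&& all (mem [:: 0; 1; -1]) (A ++ B ++ C ++ D),
      all (fun i => count (fun X : seq int => X`_i != 0) [:: A; B; C; D] == 1%N)
        (iota 0 n)
    & all (fun s => autocorr_fold A s + autocorr_fold B s +
                    autocorr_fold C s + autocorr_fold D s == 0) (iota 1 n)].

(** Shifts beyond the length need no check: the sums are then empty. *)
Lemma T_checkP (n : nat) (A B C D : n.-tuple int) :
  T_check n A B C D -> T_sequences A B C D.
Proof.
case/and3P => /allP sub /allP one /allP sum0; split=> // [i | s s_gt0].
  have /eqP <- : count (fun X : seq int => X`_i != 0)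
      [:: tval A; tval B; tval C; tval D] == 1%N by apply: one; rewrite mem_iota /=.
  by rewrite /= !(tnth_nth 0).
have [le_sn | lt_ns] := leqP s n.
  by rewrite !autocorr_foldE; apply/eqP/sum0; rewrite mem_iota s_gt0 add1n ltnS.
by rewrite /autocorr !size_tuple !big_geq // leq_subLR addn0 ltnW.
Qed.

(** * Base sequences of lengths 40, 40, 39, 39 *)

Definition base_A : seq int :=
  [::  1; -1; -1; -1; -1;  1; -1; -1;  1;  1;
      -1;  1; -1; -1;  1;  1; -1;  1; -1;  1;
      -1;  1;  1; -1;  1; -1; -1; -1;  1; -1;
      -1;  1;  1; -1; -1; -1; -1;  1; -1;  1].

Definition base_B : seq int :=
  [:: -1; -1; -1; -1;  1; -1; -1; -1;  1; -1;
       1;  1;  1; -1;  1;  1;  1;  1;  1;  1;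
      -1; -1;  1;  1;  1; -1; -1;  1;  1;  1;
       1;  1;  1; -1;  1;  1; -1;  1; -1;  1].

Definition base_C : seq int :=
  [:: -1; -1; -1;  1; -1; -1; -1; -1;  1; -1;
      -1;  1; -1;  1;  1;  1; -1;  1;  1;  1;
      -1; -1; -1; -1;  1;  1; -1;  1; -1;  1;
      -1; -1;  1;  1; -1; -1;  1; -1; -1].

Definition base_D : seq int :=
  [:: -1;  1; -1; -1; -1; -1;  1;  1;  1;  1;
       1; -1; -1; -1; -1; -1;  1;  1;  1;  1;
      -1; -1;  1;  1; -1; -1; -1; -1;  1; -1;
      -1;  1; -1;  1; -1;  1;  1;  1; -1].

Definition half_sum (X Y : seq int) : seq int :=
  [seq ((p.1 + p.2) %/ 2)%Z | p <- zip X Y].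

Definition half_diff (X Y : seq int) : seq int :=
  [seq ((p.1 - p.2) %/ 2)%Z | p <- zip X Y].

Definition T79_A : 79.-tuple int :=
  @Tuple 79 int (half_sum base_A base_B ++ nseq 39 0) isT.

Definition T79_B : 79.-tuple int :=
  @Tuple 79 int (half_diff base_A base_B ++ nseq 39 0) isT.

Definition T79_C : 79.-tuple int :=
  @Tuple 79 int (nseq 40 0 ++ half_sum base_C base_D) isT.

Definition T79_D : 79.-tuple int :=
  @Tuple 79 int (nseq 40 0 ++ half_diff base_C base_D) isT.

Lemma T_sequences79 : T_sequences T79_A T79_B T79_C T79_D.
Proof. by apply: T_checkP; vm_compute. Qed.

Theorem mainTheorem3 :
  (exists A B C D : 79.-tuple int, @T_sequences 79 A B C D) /\
  (exists M : 'M[{mpoly int[4]}]_(4 * 79), @orthogonal_design4 79 M).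
Proof.
split; last exact: orthogonal_design_of_T_sequences T_sequences79.
by exists T79_A, T79_B, T79_C, T79_D; exact: T_sequences79.
Qed.
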